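(* Let $F=\{f_i\}_{i=1}^M$ be a frame in $\mathbb{R}^N$. For $s=(s_1,\dots,s_M)$ with all $s_i\ge 0$, write $S(s)=\sum_{i=1}^M s_i^2 f_i f_i^*$. Then the following statements are equivalent: (a) $F=\{f_i\}_{i=1}^M$ is a scalable frame. (b) The problem $$\min_{s_i\ge 0,\ s\ne 0}\ \frac{\lambda_{\max}(S(s))}{\lambda_{\min}(S(s))}$$ has a global minimum solution $s^*=\{s_i^*\}$ with objective function value $1$. (c) The problem $$\min_{s_i\ge 0,\ s\ne 0,\ \sum_{i=1}^M s_i^2\|f_i\|_2^2=N}\ \lambda_{\max}(S(s))-\lambda_{\min}(S(s))$$ has a global minimum solution $s^*=\{s_i^*\}$ with objective function value $0$. (d) The problem $$\min_{s_i\ge 0,\ s\ne 0}\ \|I_N-S(s)\|_F$$ has a global minimum solution $s^*=\{s_i^*\}$ with objective function value $0$.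
   Context: A finite family $\{f_i\}_{i=1}^M\subset\mathbb{R}^N$ is a frame if there are constants $0<A\le B<\infty$ with $A\|x\|^2\le\sum_{i=1}^M|\langle x,f_i\rangle|^2\le B\|x\|^2$ for all $x\in\mathbb{R}^N$; it is a Parseval frame if one can take $A=B=1$, equivalently $\sum_{i=1}^M f_if_i^*=I_N$. A frame $\{f_i\}_{i=1}^M$ is scalable if there exist nonnegative numbers $s_1,\dots,s_M$ such that $\{s_if_i\}_{i=1}^M$ is a Parseval frame. Here $\lambda_{\max}$ and $\lambda_{\min}$ denote the largest and smallest eigenvalues of a symmetric matrix, $\|\cdot\|_2$ of a vector is the Euclidean norm, $\|\cdot\|_F$ is the Frobenius norm, $I_N$ is the $N\times N$ identity matrix, and $f^*$ is the (conjugate) transpose of the column vector $f$. The ratio in (b) is the condition number $\kappa(S(s))$, where for a symmetric positive semidefinite matrix $X$ one sets $\kappa(X)=\lambda_{\max}(X)/\lambda_{\min}(X)$ if $\lambda_{\min}(X)>0$, $\kappa(X)=\infty$ if $\lambda_{\min}(X)=0$ and $\lambda_{\max}(X)>0$, and $\kappa(X)=0$ if $X=0$.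
   Formalization: (a)⇒(b) is proved only when all f_i are nonzero: with κ(0)=0 it fails for any scalable frame containing a zero vector, e.g. {1,0} in R^1. For arbitrary frames (a)⇔(c)⇔(d) and (b)⇒(a) are proved. N ≥ 1 is assumed. *)

(* Defs.v *)
From HB Require Import structures.
From mathcomp Require Import all_boot all_order all_algebra.
From mathcomp Require Import boolp classical_sets reals constructive_ereal.

Set Implicit Arguments.
Unset Strict Implicit.
Unset Printing Implicit Defensive.

Import Order.TTheory GRing.Theory Num.Theory.
Local Open Scope classical_set_scope.
Local Open Scope ring_scope.

Section Defs.
Context {R : realType}.

Definition dotp {N : nat} (x y : 'cV[R]_N) : R := \sum_i x i 0 * y i 0.

Definition norm2 {N : nat} (x : 'cV[R]_N) : R := Num.sqrt (\sum_i x i 0 ^+ 2).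

Definition normF {m n : nat} (X : 'M[R]_(m, n)) : R :=
  Num.sqrt (\sum_i \sum_j X i j ^+ 2).

(* The spectrum of a matrix is finite, and it is nonempty when the matrix is
   symmetric of positive size: in that case the supremum and the infimum below
   are attained. *)
Definition lambda_max {N : nat} (X : 'M[R]_N) : R := sup [set a | eigenvalue X a].

Definition lambda_min {N : nat} (X : 'M[R]_N) : R := inf [set a | eigenvalue X a].

(* Meaningful for X symmetric positive semidefinite; the last branch is then
   the case X = 0. *)
Definition kappa {N : nat} (X : 'M[R]_N) : \bar R :=
  if 0 < lambda_min X then (lambda_max X / lambda_min X)%:E
  else if (lambda_min X == 0) && (0 < lambda_max X) then +oo%E
  else 0%E.

Definition frame_bounds {N M : nat} (A B : R) (f : 'I_M -> 'cV[R]_N) : Prop :=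
  forall x : 'cV[R]_N,
    A * norm2 x ^+ 2 <= \sum_i `|dotp x (f i)| ^+ 2 /\
    \sum_i `|dotp x (f i)| ^+ 2 <= B * norm2 x ^+ 2.

Definition is_frame {N M : nat} (f : 'I_M -> 'cV[R]_N) : Prop :=
  exists A B : R, [/\ 0 < A, A <= B & frame_bounds A B f].

Definition is_parseval {N M : nat} (f : 'I_M -> 'cV[R]_N) : Prop :=
  frame_bounds 1 1 f.

Definition nonneg {M : nat} (s : 'rV[R]_M) : Prop := forall i, 0 <= s 0 i.

Definition scalable_frame {N M : nat} (f : 'I_M -> 'cV[R]_N) : Prop :=
  exists s : 'rV[R]_M, nonneg s /\ is_parseval (fun i => s 0 i *: f i).

Definition frame_op {N M : nat} (f : 'I_M -> 'cV[R]_N) (s : 'rV[R]_M) : 'M[R]_N :=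
  \sum_i s 0 i ^+ 2 *: (f i *m (f i)^T).

End Defs.

(* The problem "minimize obj over feas" has a global minimum solution, at which
   the objective function has the value v. *)
Definition has_global_min {T : Type} {d : Order.disp_t} {V : porderType d}
    (feas : T -> Prop) (obj : T -> V) (v : V) : Prop :=
  exists s, [/\ feas s, obj s = v & forall t, feas t -> (obj s <= obj t)%O].

Section Problems.
Context {R : realType} {N M : nat} (f : 'I_M -> 'cV[R]_N).

Definition min_cond_is_1 : Prop :=
  has_global_min (fun s : 'rV[R]_M => nonneg s /\ s != 0)
    (fun s => kappa (frame_op f s)) 1%E.

Definition min_gap_is_0 : Prop :=
  has_global_min
    (fun s : 'rV[R]_M => [/\ nonneg s, s != 0 &
       \sum_i s 0 i ^+ 2 * norm2 (f i) ^+ 2 = N%:R])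
    (fun s => lambda_max (frame_op f s) - lambda_min (frame_op f s)) 0.

Definition min_dist_is_0 : Prop :=
  has_global_min (fun s : 'rV[R]_M => nonneg s /\ s != 0)
    (fun s => normF (1%:M - frame_op f s)) 0.

End Problems.

(* Main.v *)
(* F is scalable iff S(s) = I for some s >= 0. The spectral theorem for real
   symmetric matrices, read off from the complex Hermitian case, says that a
   nonzero symmetric matrix has a nonzero eigenvalue. Applied to S - c I, it
   shows that S = c I as soon as c is the only eigenvalue of S; applied to S, it
   shows that lambda_max S > 0 when S != 0. Hence a condition number 1 or a gap 0
   forces S(s) = c I; in the former case rescaling s by c^(-1/2) gives I, in the
   latter the constraint tr S(s) = N forces c = 1. *)
Require Import Defs.
From HB Require Import structures.
From mathcomp Require Import all_boot all_order all_algebra.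
From mathcomp Require Import boolp classical_sets reals constructive_ereal.
From mathcomp Require Import complex polyrcf.

Set Implicit Arguments.
Unset Strict Implicit.
Unset Printing Implicit Defensive.

Import Order.TTheory GRing.Theory Num.Theory.
Local Open Scope ring_scope.

(** * Spectral theorem for real symmetric matrices *)

Lemma symmetric_neq0_eigenvalue (R : rcfType) (N : nat) (X : 'M[R]_N) :
  X^T = X -> X != 0 -> exists2 a, a != 0 & eigenvalue X a.
Proof.
move=> Xsym Xn0; pose Y : 'M[R[i]]_N := map_mx (real_complex R) X.
have Yherm : Y \is hermsymmx.
  apply: realsym_hermsym.
    by apply/is_hermitianmxP; rewrite expr0 scale1r map_mx_id// map_trmx Xsym.
  by apply/mxOverP => i j; rewrite mxE; apply/complex_realP; exists (X i j).
have := hermitian_normalmx Yherm.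
move=> /orthomx_spectralP; set P := spectralmx Y; set d := spectral_diag Y => Yd.
have Pu : P \in unitmx := spectral_unit Y.
(* If the diagonal part vanished, so would [Y], and with it [X]. *)
have [i di] : exists i, d 0 i != 0.
  apply/existsP; apply: contraNT Xn0; rewrite negb_exists => /forallP d0.
  have dE : d = 0 by apply/rowP => i; rewrite mxE; apply/eqP/negPn/d0.
  move: Yd; rewrite dE [diag_mx 0]raddf0 mulmx0 mul0mx => Y0.
  by rewrite -(map_mx_eq0 (real_complex R)) -/Y Y0.
have [a da] : exists a : R, d 0 i = a%:C%C.
  by apply/complex_realP/(mxOverP (hermitian_spectral_diag_real Yherm)).
exists a; first by apply: contra di => /eqP a0; rewrite da a0 raddf0.
rewrite -(eigenvalue_map (real_complex R)) -/Y; apply/eigenvalueP.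
(* [eigenvalue] refers to row vectors: [Y = invmx P *m diag_mx d *m P] makes row [i] of [P] a left
   eigenvector for [d 0 i]. *)
exists (row i P).
  rewrite -row_mul {1}Yd !mulmxA mulmxV// mul1mx row_mul row_diag_mx.
  by rewrite -scalemxAl -rowE da.
(* A zero row of [P] would give a zero row of the identity [P *m invmx P]. *)
apply/negP => /eqP Pi0; have := row_mul i P (invmx P).
rewrite Pi0 mul0mx mulmxV// => /rowP/(_ i)/eqP.
by rewrite !mxE eqxx oner_eq0.
Qed.

Lemma symmetric_has_eigenvalue (R : rcfType) (N : nat) (X : 'M[R]_N) :
  (0 < N)%N -> X^T = X -> exists a, eigenvalue X a.
Proof.
case: N X => // N X _ Xsym; have [->|X0] := eqVneq X 0.
  exists 0; apply/eigenvalueP; exists (const_mx 1).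
    by rewrite mulmx0 scale0r.
  by apply/negP => /eqP/rowP/(_ ord0)/eqP; rewrite !mxE oner_eq0.
by have [a _ Xa] := symmetric_neq0_eigenvalue Xsym X0; exists a.
Qed.

Lemma eigenvalue_subr_scalar (F : fieldType) (N : nat) (X : 'M[F]_N) (c a : F) :
  eigenvalue (X - c%:M) a -> eigenvalue X (a + c).
Proof.
move=> /eigenvalueP[v]; rewrite mulmxBr mul_mx_scalar => /eqP.
rewrite subr_eq -scalerDl => /eqP vX v0.
by apply/eigenvalueP; exists v.
Qed.

Lemma symmetric_eigenvalue_scalar (R : rcfType) (N : nat) (X : 'M[R]_N) (c : R) :
  X^T = X -> (forall a, eigenvalue X a -> a = c) -> X = c%:M.
Proof.
move=> Xsym Xc; apply/eqP; rewrite -subr_eq0; apply/negPn/negP => X0.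
have [|a a0 /eigenvalue_subr_scalar/Xc/eqP] := symmetric_neq0_eigenvalue _ X0.
  by rewrite linearB /= Xsym tr_scalar_mx.
by rewrite -subr_eq0 addrK (negPf a0).
Qed.

(** * Extreme eigenvalues *)

Section Frames.
Context {R : realType}.
Implicit Types (N M : nat).

(** Eigenvalues are roots of the characteristic polynomial. Boundedness keeps the [sup] and [inf] in
    [lambda_max] and [lambda_min] from being default values. *)
Lemma eigenvalue_bounded N (X : 'M[R]_N) :
  exists B, forall a, eigenvalue X a -> `|a| <= B.
Proof.
exists (cauchy_bound (char_poly X)) => a.
rewrite eigenvalue_root_char => /rootP Xa.
by rewrite ltW// cauchy_boundP// monic_neq0// char_poly_monic.
Qed.

Lemma eigenvalue_lambda N (X : 'M[R]_N) (a : R) :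
  eigenvalue X a -> lambda_min X <= a <= lambda_max X.
Proof.
move=> Xa; have [B XB] := eigenvalue_bounded X.
apply/andP; split; [apply: ge_inf|apply: ub_le_sup] => //.
  by exists (- B) => b /XB; rewrite ler_norml => /andP[].
by exists B => b /XB; rewrite ler_norml => /andP[].
Qed.

Lemma lambda_min_le_max N (X : 'M[R]_N) :
  (0 < N)%N -> X^T = X -> lambda_min X <= lambda_max X.
Proof.
move=> N0 /(symmetric_has_eigenvalue N0)[a] /eigenvalue_lambda/andP[].
exact: le_trans.
Qed.

Lemma lambda_min_eq_max N (X : 'M[R]_N) :
  X^T = X -> lambda_max X = lambda_min X -> X = (lambda_min X)%:M.
Proof.
move=> Xsym eq_l; apply: symmetric_eigenvalue_scalar => // a.
by move=> /eigenvalue_lambda; rewrite eq_l => /le_anti.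
Qed.

Lemma eigenvalue_scalar N (c a : R) :
  (0 < N)%N -> eigenvalue (c%:M : 'M_N) a = (a == c).
Proof.
case: N => // N _; apply/eigenvalueP/eqP => [[v]|->].
  rewrite mul_mx_scalar => /eqP; rewrite -subr_eq0 -scalerBl scaler_eq0 subr_eq0.
  by case/orP=> [/eqP->//|->].
exists (const_mx 1); first by rewrite mul_mx_scalar.
by apply/negP => /eqP/rowP/(_ ord0)/eqP; rewrite !mxE oner_eq0.
Qed.

Lemma spectrum_scalar N (c : R) : (0 < N)%N ->
  [set a | eigenvalue (c%:M : 'M_N) a]%classic = [set c]%classic.
Proof.
by move=> N0; apply/seteqP; split=> a /=; rewrite eigenvalue_scalar// => /eqP.
Qed.

Lemma lambda_max_scalar N (c : R) : (0 < N)%N -> lambda_max (c%:M : 'M_N) = c.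
Proof. by move=> N0; rewrite /lambda_max spectrum_scalar// sup1. Qed.

Lemma lambda_min_scalar N (c : R) : (0 < N)%N -> lambda_min (c%:M : 'M_N) = c.
Proof. by move=> N0; rewrite /lambda_min spectrum_scalar// inf1. Qed.

(** * Inner products, quadratic forms and norms *)

Lemma dotpE N (x y : 'cV[R]_N) : dotp x y = (x^T *m y) 0 0.
Proof. by rewrite mxE; apply: eq_bigr => i _; rewrite mxE. Qed.

Lemma norm2_sqr N (x : 'cV[R]_N) : norm2 x ^+ 2 = dotp x x.
Proof. by rewrite sqr_sqrtr ?sumr_ge0// => i _; rewrite sqr_ge0. Qed.

Lemma dotp_gt0 N (x : 'cV[R]_N) : x != 0 -> 0 < dotp x x.
Proof.
move=> x0; rewrite lt_def sumr_ge0 ?andbT => [|i _]; last exact: sqr_ge0.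
apply: contra x0; rewrite psumr_eq0 => [/allP xx|i _]; last exact: sqr_ge0.
apply/eqP/colP => i; rewrite mxE; apply/eqP.
by have := xx i (mem_index_enum i); rewrite -expr2 sqrf_eq0.
Qed.

(** Transposing a left eigenvector gives the column vector to test the frame inequalities on. *)
Lemma eigenvalue_quadratic_form N (X : 'M[R]_N) (a : R) : eigenvalue X a ->
  exists2 x : 'cV[R]_N, x != 0 & (x^T *m X *m x) 0 0 = a * dotp x x.
Proof.
move=> /eigenvalueP[v vX v0]; exists v^T; first by rewrite trmx_eq0.
by rewrite dotpE trmxK vX -scalemxAl mxE.
Qed.

Lemma normF_eq0 m n (X : 'M[R]_(m, n)) : normF X = 0 -> X = 0.
Proof.
have X_ge0 i : 0 <= \sum_j X i j ^+ 2 by apply: sumr_ge0 => j _; apply: sqr_ge0.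
move=> /eqP; rewrite sqrtr_eq0 => X0; apply/matrixP => i j; rewrite mxE.
have /eqP : \sum_i \sum_j X i j ^+ 2 = 0 by apply/le_anti; rewrite X0 sumr_ge0.
rewrite psumr_eq0// => /allP/(_ i (mem_index_enum i)) /=.
rewrite psumr_eq0 => [|k _]; last exact: sqr_ge0.
by move=> /allP/(_ j (mem_index_enum j)); rewrite /= sqrf_eq0 => /eqP.
Qed.

(** * The operator S(s) and the Parseval property *)

Lemma trmx_frame_op N M (f : 'I_M -> 'cV[R]_N) s :
  (frame_op f s)^T = frame_op f s.
Proof.
rewrite /frame_op linear_sum; apply: eq_bigr => i _ /=.
by rewrite linearZ /= trmx_mul trmxK.
Qed.

(** Since x^* f f^* x = <x, f>^2, the sum in the frame bounds of the scaled family is the quadratic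
    form of S(s). *)
Lemma frame_op_quadratic_form N M (f : 'I_M -> 'cV[R]_N) s (x : 'cV[R]_N) :
  (x^T *m frame_op f s *m x) 0 0 = \sum_i `|dotp x (s 0 i *: f i)| ^+ 2.
Proof.
rewrite mulmx_sumr mulmx_suml summxE; apply: eq_bigr => i _.
rewrite real_normK ?num_real// dotpE -!scalemxAr -scalemxAl.
rewrite [LHS]mxE [X in _ = X ^+ 2]mxE exprMn; congr (_ * _).
rewrite mulmxA -(mulmxA (x^T *m f i)) mxE big_ord1 expr2; congr (_ * _).
by rewrite -[x in LHS]trmxK -trmx_mul mxE.
Qed.

Lemma frame_op_eigenvalue_ge0 N M (f : 'I_M -> 'cV[R]_N) s a :
  eigenvalue (frame_op f s) a -> 0 <= a.
Proof.
move=> /eigenvalue_quadratic_form[x x0]; rewrite frame_op_quadratic_form => xa.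
by rewrite -(pmulr_lge0 _ (dotp_gt0 x0)) -xa sumr_ge0// => i _; apply: sqr_ge0.
Qed.

Lemma lambda_min_frame_op_ge0 N M (f : 'I_M -> 'cV[R]_N) s :
  (0 < N)%N -> 0 <= lambda_min (frame_op f s).
Proof.
move=> N0; have [a Xa] := symmetric_has_eigenvalue N0 (trmx_frame_op f s).
apply: lb_le_inf; first by exists a.
by move=> b; apply: frame_op_eigenvalue_ge0.
Qed.

Lemma mxtrace_frame_op N M (f : 'I_M -> 'cV[R]_N) s :
  \tr (frame_op f s) = \sum_i s 0 i ^+ 2 * norm2 (f i) ^+ 2.
Proof.
rewrite /frame_op raddf_sum; apply: eq_bigr => i _ /=.
by rewrite mxtraceZ mxtrace_mulC norm2_sqr dotpE /mxtrace big_ord1.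
Qed.

(** The trace is a sum of nonnegative terms, so S(s) = 0 kills each s_i^2 ||f_i||^2, hence each
    s_i. *)
Lemma frame_op_neq0 N M (f : 'I_M -> 'cV[R]_N) s :
  (forall i, f i != 0) -> s != 0 -> frame_op f s != 0.
Proof.
move=> f0; apply: contra => /eqP S0.
have := mxtrace_frame_op f s; rewrite S0 mxtrace0 => /esym/eqP.
rewrite psumr_eq0 => [/allP tr0|i _]; last by rewrite mulr_ge0 ?sqr_ge0.
apply/eqP/rowP => i; rewrite mxE; apply/eqP.
have := tr0 i (mem_index_enum i).
by rewrite /= norm2_sqr mulf_eq0 sqrf_eq0 (gt_eqF (dotp_gt0 (f0 i))) orbF.
Qed.

Lemma frame_op0 N M (f : 'I_M -> 'cV[R]_N) : frame_op f 0 = 0.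
Proof. by rewrite /frame_op big1// => i _; rewrite mxE expr0n scale0r. Qed.

Lemma frame_opZ N M (f : 'I_M -> 'cV[R]_N) (c : R) s :
  frame_op f (c *: s) = c ^+ 2 *: frame_op f s.
Proof.
rewrite /frame_op scaler_sumr; apply: eq_bigr => i _.
by rewrite mxE exprMn scalerA.
Qed.

(** The Parseval identity at an eigenvector for [a] reads a ||x||^2 = ||x||^2; thus 1 is the only
    eigenvalue of the symmetric S(s). *)
Lemma parsevalP N M (f : 'I_M -> 'cV[R]_N) (s : 'rV[R]_M) :
  is_parseval (fun i => s 0 i *: f i) <-> frame_op f s = 1%:M.
Proof.
split=> [parseval|S1 x]; last first.
  by rewrite -frame_op_quadratic_form S1 mulmx1 -dotpE norm2_sqr mul1r.
apply: symmetric_eigenvalue_scalar => [|a]; first exact: trmx_frame_op.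
move=> /eigenvalue_quadratic_form[x x0]; rewrite frame_op_quadratic_form => xa.
have [] := parseval x; rewrite xa mul1r norm2_sqr => le1 le2.
apply/(mulIf (lt0r_neq0 (dotp_gt0 x0))); rewrite mul1r.
by apply/le_anti; rewrite le1 le2.
Qed.

Lemma scalableP N M (f : 'I_M -> 'cV[R]_N) : (0 < N)%N ->
  scalable_frame f <->
  exists s : 'rV[R]_M, [/\ nonneg s, s != 0 & frame_op f s = 1%:M].
Proof.
move=> N0; split=> [[s [s_ge0 /parsevalP S1]]|[s [s_ge0 _ S1]]]; exists s.
  (* The feasible sets ask for [s != 0]: this holds because S(0) = 0 differs from the identity in
     positive dimension. *)
  split=> //; apply/eqP => s0; move: S1; rewrite s0 frame_op0 => /esym/matrixP.
  move=> /(_ (Ordinal N0) (Ordinal N0))/eqP.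
  by rewrite !mxE eqxx oner_eq0.
by split=> //; apply/parsevalP.
Qed.

Lemma scalable_of_scalar N M (f : 'I_M -> 'cV[R]_N) (c : R) s :
  0 < c -> nonneg s -> frame_op f s = c%:M -> scalable_frame f.
Proof.
(* S is homogeneous of degree 2 in [s], whence the square root. *)
move=> c_gt0 s_ge0 Sc; exists (Num.sqrt c^-1 *: s); split.
  by move=> i; rewrite mxE mulr_ge0 ?sqrtr_ge0.
apply/parsevalP; rewrite frame_opZ Sc scale_scalar_mx sqr_sqrtr ?invr_ge0 ?ltW//.
by rewrite mulVf ?gt_eqF.
Qed.

(** * Scalability and the three minimization problems *)

Lemma kappa_frame_op_ge1 N M (f : 'I_M -> 'cV[R]_N) s : (0 < N)%N ->
  frame_op f s != 0 -> (1%E <= kappa (frame_op f s))%E.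
Proof.
move=> N0 S0; have Ssym := trmx_frame_op f s; rewrite /kappa.
case: ifPn => [min_gt0|min_le0].
  by rewrite lee_fin ler_pdivlMr// mul1r lambda_min_le_max.
(* Here [lambda_min] is 0, and a nonzero eigenvalue, positive by semidefiniteness, makes
   [lambda_max] positive: [kappa] is [+oo] and not 0. *)
have min_ge0 := lambda_min_frame_op_ge0 f s N0.
have [a a0 Sa] := symmetric_neq0_eigenvalue Ssym S0.
have /andP[_ /(lt_le_trans _)->] := eigenvalue_lambda Sa.
  by rewrite -leNgt in min_le0; rewrite eq_le min_le0 min_ge0 leey.
by rewrite lt_def a0 (frame_op_eigenvalue_ge0 Sa).
Qed.

Lemma scalable_min_cond N M (f : 'I_M -> 'cV[R]_N) : (0 < N)%N ->
  (forall i, f i != 0) -> scalable_frame f -> min_cond_is_1 f.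
Proof.
move=> N0 f0 /(scalableP _ N0)[s [s_ge0 s0 S1]].
have kappa1 : kappa (frame_op f s) = 1%E.
  by rewrite S1 /kappa lambda_min_scalar// lambda_max_scalar// ltr01 divr1.
exists s; split=> // t [_ t0].
by rewrite kappa1; apply: kappa_frame_op_ge1 => //; apply: frame_op_neq0.
Qed.

Lemma min_cond_scalable N M (f : 'I_M -> 'cV[R]_N) :
  min_cond_is_1 f -> scalable_frame f.
Proof.
move=> [s [[s_ge0 _] + _]]; rewrite /kappa.
case: ifPn => [min_gt0 [ratio1]|_]; last first.
  (* The remaining values of [kappa], [+oo] and 0, differ from 1. *)
  by case: ifP => _ // [/esym/eqP]; rewrite oner_eq0.
have eq_l : lambda_max (frame_op f s) = lambda_min (frame_op f s).
  by rewrite -[LHS](divfK (lt0r_neq0 min_gt0)) ratio1 mul1r.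
apply: scalable_of_scalar min_gt0 s_ge0 _.
exact: lambda_min_eq_max (trmx_frame_op f s) eq_l.
Qed.

Lemma scalable_min_gap N M (f : 'I_M -> 'cV[R]_N) :
  (0 < N)%N -> scalable_frame f -> min_gap_is_0 f.
Proof.
move=> N0 /(scalableP _ N0)[s [s_ge0 s0 S1]].
have gap0 : lambda_max (frame_op f s) - lambda_min (frame_op f s) = 0.
  by rewrite S1 lambda_min_scalar// lambda_max_scalar// subrr.
exists s; split=> // [|t _].
  by split=> //; rewrite -mxtrace_frame_op S1 mxtrace1.
by rewrite gap0 subr_ge0 lambda_min_le_max// trmx_frame_op.
Qed.

Lemma min_gap_scalable N M (f : 'I_M -> 'cV[R]_N) :
  (0 < N)%N -> min_gap_is_0 f -> scalable_frame f.
Proof.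
move=> N0 [s [[s_ge0 _ trS] /subr0_eq eq_l _]].
have := lambda_min_eq_max (trmx_frame_op f s) eq_l.
move: (lambda_min _) => c Sc; apply: (scalable_of_scalar _ s_ge0 Sc).
move: trS; rewrite -mxtrace_frame_op Sc mxtrace_scalar => cN.
(* From c N = N > 0 only the positivity of [c] is drawn, as [scalable_of_scalar] rescales. *)
by rewrite -(@pmulrn_lgt0 _ c N)// cN ltr0n.
Qed.

Lemma scalable_min_dist N M (f : 'I_M -> 'cV[R]_N) :
  (0 < N)%N -> scalable_frame f -> min_dist_is_0 f.
Proof.
move=> N0 /(scalableP _ N0)[s [s_ge0 s0 S1]].
have dist0 : normF (1%:M - frame_op f s) = 0.
  rewrite S1 subrr /normF big1 ?sqrtr0// => i _.
  by rewrite big1// => j _; rewrite mxE expr0n.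
by exists s; split=> // t _; rewrite dist0 sqrtr_ge0.
Qed.

Lemma min_dist_scalable N M (f : 'I_M -> 'cV[R]_N) :
  min_dist_is_0 f -> scalable_frame f.
Proof.
move=> [s [[s_ge0 _] /normF_eq0/subr0_eq/esym S1 _]].
by exists s; split=> //; apply/parsevalP.
Qed.

End Frames.

(* A zero vector f i makes S(s) = 0, of condition number 0, for some s != 0, so
   that the minimum of the condition number is then 0 and never 1. Hence the
   only implication that needs nonzero vectors is the one from scalability to
   min_cond_is_1. *)
Theorem lemma1 (R : realType) (N M : nat) (f : 'I_M -> 'cV[R]_N)
    (N_gt0 : (0 < N)%N) (frame_f : is_frame f) :
  [/\ (forall i, f i != 0) ->
        [<-> scalable_frame f; min_cond_is_1 f; min_gap_is_0 f; min_dist_is_0 f],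
      [<-> scalable_frame f; min_gap_is_0 f; min_dist_is_0 f] &
      min_cond_is_1 f -> scalable_frame f].
Proof.
split=> [f0||]; last exact: min_cond_scalable.
  (* Each problem leads to the next one through scalability. *)
  tfae.
  - exact: scalable_min_cond.
  - by move=> /min_cond_scalable; apply: scalable_min_gap.
  - by move=> /(min_gap_scalable N_gt0); apply: scalable_min_dist.
  - exact: min_dist_scalable.
tfae.
- exact: scalable_min_gap.
- by move=> /(min_gap_scalable N_gt0); apply: scalable_min_dist.
- exact: min_dist_scalable.
Qed.
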